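(* Let $M=S^2\times S^2\times S^2$ and let $\mathcal{H}=(H,I,J)\colon M\to\mathbb{R}^3$, where $$H(X,Y,Z)=|X+Y+Z|,\qquad I(X,Y,Z)=\langle X+Y+Z,e_3\rangle,\qquad J(X,Y,Z)=\det(X,Y,Z).$$ Then the regular fibers of $\mathcal{H}$ are all connected; that is, $\mathcal{H}^{-1}(c)$ is connected for every $c\in\mathcal{H}(M)$ that is not a critical value of $\mathcal{H}$.
   Context: $S^2\subset\mathbb{R}^3$ is the unit sphere, $\langle\cdot,\cdot\rangle$ and $|\cdot|$ are the Euclidean inner product and norm, and $e_3=(0,0,1)$. The function $H$ is smooth on $M\setminus H^{-1}(0)$, while $I$ and $J$ are smooth on $M$. A critical point of $\mathcal{H}$ is a point of $M\setminus H^{-1}(0)$ at which $dH,dI,dJ$ are linearly dependent, or a point of $H^{-1}(0)$ (where $H$ is not smooth; this set is counted as critical). A critical value is the image under $\mathcal{H}$ of a critical point. *)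

(* Defs.v *)
From mathcomp Require Import all_boot all_order all_algebra.
From mathcomp Require Import all_classical all_reals all_analysis.

Set Implicit Arguments.
Unset Strict Implicit.
Unset Printing Implicit Defensive.

Import Order.TTheory GRing.Theory Num.Theory.
Import numFieldNormedType.Exports.
Local Open Scope classical_set_scope.
Local Open Scope ring_scope.

(* The norm `|u| of MathComp-Analysis on 'rV[R]_3 is the sup norm: it is used
   only through the topology and the differentials it induces, while the
   Euclidean norm of R^3 is enorm. *)
Definition dotp (R : realType) (u v : 'rV[R]_3) : R :=
  \sum_(i < 3) u 0 i * v 0 i.

Definition enorm (R : realType) (u : 'rV[R]_3) : R := Num.sqrt (dotp u u).

Definition e3 (R : realType) : 'rV[R]_3 := delta_mx 0 ord_max.
Arguments e3 {R}.

Definition sphere2 (R : realType) : set 'rV[R]_3 := [set u | enorm u = 1].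

(* R^3 x R^3 x R^3; a point p = (X, Y, Z) has X = p.1.1, Y = p.1.2, Z = p.2. *)
Notation triples R := ('rV[R]_3 * 'rV[R]_3 * 'rV[R]_3)%type.

Definition M (R : realType) : set (triples R) :=
  @sphere2 R `*` @sphere2 R `*` @sphere2 R.

(* fH, fI and fJ are given by their formulas on the whole of R^3 x R^3 x R^3;
   only their restrictions to M matter below. *)
Definition fH (R : realType) (p : triples R) : R^o :=
  let: (X, Y, Z) := p in enorm (X + Y + Z).

Definition fI (R : realType) (p : triples R) : R^o :=
  let: (X, Y, Z) := p in dotp (X + Y + Z) e3.

Definition fJ (R : realType) (p : triples R) : R^o :=
  let: (X, Y, Z) := p in \det (\matrix_(i < 3) [:: X; Y; Z]`_i).

Definition HIJ (R : realType) (p : triples R) : R * R * R := (fH p, fI p, fJ p).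

(* The tangent space of M at p = (X, Y, Z), as a subspace of the ambient
   space: T_X S^2 x T_Y S^2 x T_Z S^2, where T_X S^2 is the plane orthogonal
   to X. *)
Definition tangentM (R : realType) (p : triples R) : set (triples R) :=
  [set v | [/\ dotp v.1.1 p.1.1 = 0, dotp v.1.2 p.1.2 = 0 & dotp v.2 p.2 = 0]].

(* The differential at p of the restriction to M of a function differentiable
   at p is the restriction to tangentM p of the ambient differential 'd _ p;
   hence linear dependence is tested on tangent vectors only. *)
Definition differentials_dependent (R : realType) (p : triples R) : Prop :=
  exists a b c : R, (a, b, c) <> (0, 0, 0) /\
    forall v, tangentM p v ->
      a * 'd (@fH R) p v + b * 'd (@fI R) p v + c * 'd (@fJ R) p v = 0.

Definition critical_points (R : realType) : set (triples R) :=
  [set p | M p /\ (fH p = 0 \/ (fH p <> 0 /\ differentials_dependent p))].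

Definition critical_values (R : realType) : set (R * R * R) :=
  @HIJ R @` @critical_points R.

Definition fiber (R : realType) (c : R * R * R) : set (triples R) :=
  @M R `&` @HIJ R @^-1` [set c].

(* Main.v *)
From HB Require Import structures.
Require Import Defs.
From mathcomp Require Import all_boot all_order all_algebra.
From mathcomp Require Import all_classical all_reals all_analysis.
From mathcomp Require Import ring lra.

Import Order.TTheory GRing.Theory Num.Theory.
Import numFieldNormedType.Exports.
Local Open Scope classical_set_scope.
Local Open Scope ring_scope.

(** Put W = X + Y + Z, so that H = |W|, and let h, i, j be the values of H, I, J,
    with h > 0. The vector W runs over a circle of latitude, and the rotations
    about e_3 move it along this circle; so the question is about the triples with
    a given sum W, which are acted on by the rotations about W.

    For a given X put S = Y + Z = W - X and D = Y - Z. The conditions |Y| = |Z| = 1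
    say that D is orthogonal to S and |D|^2 = 4 - |S|^2, and det(X, Y, Z) = j says
    <W x X, D> = 2 j. Since W x X is orthogonal to S as well, D lies on a circle
    in the plane orthogonal to S and has a prescribed component along W x X:
    there are two solutions D, exchanged by a sign e, when the circle reaches
    that component. Whether it does depends only on the height x of X along W,
    and the condition is that a cubic in x, a product of three affine factors, be
    at least 4 j^2; by log-concavity the admissible x form an interval
    ([heights_itv]).

    Hence for each sign e the triples of that sign are the continuous image of a
    product of an interval (the height x) and two circles (the rotations about W
    and about e_3), and the fiber is the union of these two connected sheets
    ([normal_form_onto], [chart_joined]). The sheets meet ([sheets_meet]): for
    j <> 0 at an end of the interval, where the projection of D to the plane of W
    and X vanishes; for j = 0 at X = W / |W|, where the rotation about W by a
    half-turn exchanges the two solutions.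

    The parametrization breaks down only where W = 0 or S = 0. The first is
    excluded because H = 0 is critical. The second means X = W, so that h = 1
    and j = 0, and (1, i, 0) is a critical value because dH vanishes at
    (W, W, -W) ([critical_value_antipodal]). *)

Set Implicit Arguments.
Unset Strict Implicit.
Unset Printing Implicit Defensive.

Section Fibers.
Context {R : realType}.
Implicit Types (a b c x y z h i j t e : R) (u v w : 'rV[R]_3) (A B : 'M[R]_3).
Implicit Types p q : triples R.

(** * Coordinates *)

Definition row3 a b c : 'rV[R]_3 := \row_(k < 3) [:: a; b; c]`_k.

Definition rows3 u v w : 'M[R]_3 := \matrix_(k < 3) [:: u; v; w]`_k.

Lemma row3P u : exists a b c, u = row3 a b c.
Proof.
exists (u 0 0), (u 0 1), (u 0 ord_max).
apply/rowP => k; rewrite mxE.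
by case: k => [[|[|[|//]]] ?]; congr (u _ _); apply: val_inj.
Qed.

Lemma sum3E (V : nmodType) (F : 'I_3 -> V) :
  \sum_(k < 3) F k = F 0 + F 1 + F ord_max.
Proof.
rewrite !big_ord_recl big_ord0 addr0 addrA.
by congr (_ + F _ + F _); apply: val_inj.
Qed.

Lemma mul_row3 a b c u v w :
  row3 a b c *m rows3 u v w = a *: u + b *: v + c *: w.
Proof. by apply/rowP => k; rewrite !mxE sum3E !mxE. Qed.

Lemma scale_row3 t a b c : t *: row3 a b c = row3 (t * a) (t * b) (t * c).
Proof.
by apply/rowP => k; rewrite !mxE; case: k => [[|[|[|//]]] ?].
Qed.

Lemma add_row3 a b c x y z :
  row3 a b c + row3 x y z = row3 (a + x) (b + y) (c + z).
Proof.
by apply/rowP => k; rewrite !mxE; case: k => [[|[|[|//]]] ?].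
Qed.

Lemma row3_inj a b c x y z :
  row3 a b c = row3 x y z -> [/\ a = x, b = y & c = z].
Proof.
move=> /rowP e; have := (e 0, e 1, e ord_max); rewrite !mxE /=.
by case=> [[]].
Qed.

Lemma dotp_row3 a b c x y z :
  dotp (row3 a b c) (row3 x y z) = a * x + b * y + c * z.
Proof. by rewrite /dotp sum3E !mxE. Qed.

Lemma dotp_e3 a b c : dotp (row3 a b c) e3 = c.
Proof. by rewrite /dotp sum3E !mxE /= !mulr0 mulr1 !add0r. Qed.

Lemma det_row3 (a1 a2 a3 b1 b2 b3 c1 c2 c3 : R) :
  \det (rows3 (row3 a1 a2 a3) (row3 b1 b2 b3) (row3 c1 c2 c3)) =
  a1 * (b2 * c3 - b3 * c2) - a2 * (b1 * c3 - b3 * c1)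
  + a3 * (b1 * c2 - b2 * c1).
Proof.
rewrite !(expand_det_row _ ord0) !big_ord_recl !big_ord0 /cofactor.
rewrite !(expand_det_row _ ord0) !big_ord_recl !big_ord0 /cofactor !det_mx11.
rewrite !mxE /=.
ring.
Qed.

Lemma polar_coordinates a b t : 0 <= t -> a ^+ 2 + b ^+ 2 = t ^+ 2 ->
  exists phi, a = t * cos phi /\ b = t * sin phi.
Proof.
rewrite le_eqVlt => /predU1P[<-|t0 e].
  rewrite expr0n/= => e; exists 0; rewrite !mul0r.
  split; nra.
have tn0 : t != 0 by rewrite gt_eqF.
have at1 : -1 <= a / t <= 1.
  rewrite ler_pdivlMr// ler_pdivrMr// mulN1r mul1r.
  apply/andP; split; nra.
have sqE : t * Num.sqrt (1 - (a / t) ^+ 2) = `|b|.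
  rewrite -sqrtr_sqr -{1}(ger0_norm (ltW t0)) -sqrtr_sqr -sqrtrM ?sqr_ge0//.
  congr Num.sqrt; rewrite mulrBr mulr1 expr_div_n mulrC mulfVK ?sqrf_eq0//.
  by rewrite -e; ring.
have [b0|b0] := leP 0 b.
- exists (acos (a / t)); rewrite acosK ?in_itv//= sin_acos// sqE ger0_norm//.
  by rewrite mulrC divfK.
- exists (- acos (a / t)); rewrite cosN sinN acosK ?in_itv//= sin_acos//.
  by rewrite mulrN sqE ltr0_norm// opprK mulrC divfK.
Qed.

(** * Admissible heights *)

(** The value of |Y - Z|^2 = 4 - |W - X|^2 when |W| = h and x is the height of X
    along W. *)
Definition sq_diff h x := 3 - h ^+ 2 + h * x *+ 2.

(** The heights x of X along W, |W| = h, for which the circle of vectors D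
    orthogonal to W - X with |D|^2 = 4 - |W - X|^2 reaches the plane
    <W x X, D> = 2 j: the component of D along the unit vector of W x X is then
    2 j / |W x X| with |W x X|^2 = h^2 (1 - x^2), and its square is at most
    |D|^2. *)
Definition heights h j : set R := [set x | [/\ x ^+ 2 <= 1, 0 <= sq_diff h x &
  (j *+ 2) ^+ 2 <= h ^+ 2 * ((1 - x ^+ 2) * sq_diff h x)]].

(** The cubic P(x) = (1 - x)(1 + x)(3 - h^2 + 2 h x) is a product of three affine
    factors, hence log-concave where they are nonnegative, and its superlevel
    sets there are intervals. A direct argument replaces logarithms: a dip of P
    at y would make its second divided difference at x, y, z positive, which
    forces y + z < 0; then the first one at x, y is nonnegative. *)
Lemma heights_itv h j x y z : 0 < h -> heights h j x -> heights h j z ->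
  x <= y <= z -> heights h j y.
Proof.
rewrite /heights /sq_diff /= => h0 [x1 gx px] [z1 gz pz] /andP[xy yz].
have xN1 : -1 <= x by nra.
have z_1 : z <= 1 by nra.
have y1 : y ^+ 2 <= 1 by nra.
have gy : 0 <= 3 - h ^+ 2 + h * y *+ 2 by nra.
split=> //; rewrite leNgt; apply/negP => py.
have h2 : 0 < h ^+ 2 by rewrite exprn_gt0.
(* If y were not admissible, the constraint P would dip at y below its values at
   x and z. *)
set P := fun x => (1 - x ^+ 2) * (3 - h ^+ 2 + h * x *+ 2) in px py pz.
have Pyx : P y < P x by rewrite -(ltr_pM2l h2); exact: lt_le_trans px.
have Pyz : P y < P z by rewrite -(ltr_pM2l h2); exact: lt_le_trans pz.
(* The divided difference of the cubic P. *)
set q := fun x y =>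
  (x + y) * (h ^+ 2 - 3) + h * (1 - x ^+ 2 - x * y - y ^+ 2) *+ 2.
have qE a b : P a - P b = (a - b) * q a b by rewrite /P /q; ring.
have qxy : q x y < 0 by have := qE x y; nra.
have qyz : 0 < q y z by have := qE y z; nra.
have qD : q y z - q x y = (z - x) * (h ^+ 2 - 3 - h * (x + y + z) *+ 2).
  by rewrite /q; ring.
have yz0 : y + z < 0.
  have : 0 < h ^+ 2 - 3 - h * (x + y + z) *+ 2 by nra.
  nra.
suff : 0 <= q x y by rewrite leNgt qxy.
have -> : q x y =
    - (x + y) * (3 - h ^+ 2 + h * x *+ 2) + h * (1 - y ^+ 2) *+ 2.
  by rewrite /q; ring.
apply: addr_ge0; last by rewrite pmulrn_lge0// mulr_ge0 ?subr_ge0// ltW.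
apply: mulr_ge0 => //; lra.
Qed.

(** * Rotations *)

Lemma dotpE u v : dotp u v = (u *m v^T) 0 0.
Proof. by rewrite !mxE; apply: eq_bigr => k _; rewrite mxE. Qed.

Lemma dotp_ge0 u : 0 <= dotp u u.
Proof. by apply: sumr_ge0 => k _; rewrite -expr2 sqr_ge0. Qed.

Lemma enorm_eq u t : 0 <= t -> (enorm u = t) <-> (dotp u u = t ^+ 2).
Proof.
move=> t0; rewrite /enorm; split=> [<-|->].
  by rewrite sqr_sqrtr// dotp_ge0.
by rewrite sqrtr_sqr ger0_norm.
Qed.

Definition is_rot A := A *m A^T = 1%:M /\ \det A = 1.

Lemma is_rotM A B : is_rot A -> is_rot B -> is_rot (A *m B).
Proof.
move=> [oA dA] [oB dB]; split; last by rewrite det_mulmx dA dB mulr1.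
by rewrite trmx_mul mulmxA -(mulmxA A) oB mulmx1.
Qed.

Lemma is_rotT A : is_rot A -> is_rot A^T.
Proof. by move=> [oA dA]; split; rewrite ?det_tr// trmxK (mulmx1C oA). Qed.

Lemma dotp_rot A u v : is_rot A -> dotp (u *m A) (v *m A) = dotp u v.
Proof.
by move=> [oA _]; rewrite !dotpE trmx_mul mulmxA -(mulmxA u) oA mulmx1.
Qed.

Lemma rows3_mul u v w A : rows3 (u *m A) (v *m A) (w *m A) = rows3 u v w *m A.
Proof.
apply/row_matrixP => k; rewrite row_mul !rowK.
by case: k => [[|[|[|//]]] ?].
Qed.

Lemma det_rot A u v w : is_rot A ->
  \det (rows3 (u *m A) (v *m A) (w *m A)) = \det (rows3 u v w).
Proof. by move=> [_ dA]; rewrite rows3_mul det_mulmx dA mulr1. Qed.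

(** The three factors of the Euler decomposition used below. They act on row
    vectors on the right, so their rows are the images of the basis vectors. *)
Definition rotx c s : 'M[R]_3 :=
  rows3 (row3 1 0 0) (row3 0 c s) (row3 0 (- s) c).

Definition roty c s : 'M[R]_3 :=
  rows3 (row3 c 0 s) (row3 0 1 0) (row3 (- s) 0 c).

Definition rotz c s : 'M[R]_3 :=
  rows3 (row3 c s 0) (row3 (- s) c 0) (row3 0 0 1).

Lemma is_rot_rows3 u v w : dotp u u = 1 -> dotp v v = 1 -> dotp w w = 1 ->
  dotp u v = 0 -> dotp u w = 0 -> dotp v w = 0 -> \det (rows3 u v w) = 1 ->
  is_rot (rows3 u v w).
Proof.
move=> uu vv ww uv uw vw d; split=> //.
have dotpC (x y : 'rV[R]_3) : dotp x y = dotp y x.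
  by apply: eq_bigr => k _; rewrite mulrC.
apply/matrixP => k l; rewrite [LHS]mxE.
transitivity (dotp [:: u; v; w]`_k [:: u; v; w]`_l).
  by apply: eq_bigr => m _; rewrite !mxE.
rewrite !mxE; case: k l => [[|[|[|//]]] ?] [[|[|[|//]]] ?] //=.
all: by rewrite dotpC.
Qed.

Lemma is_rotx c s : c ^+ 2 + s ^+ 2 = 1 -> is_rot (rotx c s).
Proof.
move=> e; apply: is_rot_rows3; rewrite ?det_row3 ?dotp_row3; nra.
Qed.

Lemma is_roty c s : c ^+ 2 + s ^+ 2 = 1 -> is_rot (roty c s).
Proof.
move=> e; apply: is_rot_rows3; rewrite ?det_row3 ?dotp_row3; nra.
Qed.

Lemma is_rotz c s : c ^+ 2 + s ^+ 2 = 1 -> is_rot (rotz c s).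
Proof.
move=> e; apply: is_rot_rows3; rewrite ?det_row3 ?dotp_row3; nra.
Qed.

Definition rotate p A : triples R := (p.1.1 *m A, p.1.2 *m A, p.2 *m A).

Lemma rotateM p A B : rotate p (A *m B) = rotate (rotate p A) B.
Proof. by rewrite /rotate /= !mulmxA. Qed.

Lemma rotateK A p : is_rot A -> rotate (rotate p A^T) A = p.
Proof.
move=> [oA _]; rewrite -rotateM (mulmx1C oA) /rotate !mulmx1.
by case: p => -[].
Qed.

(** * Triples whose sum lies on the first axis *)

(** W = X + Y + Z has been brought to (h, 0, 0). The remaining freedom is the
    rotation about the first axis, which becomes the rotation about W. *)
Definition aligned h j p := [/\ dotp p.1.1 p.1.1 = 1, dotp p.1.2 p.1.2 = 1,
  dotp p.2 p.2 = 1, p.1.1 + p.1.2 + p.2 = row3 h 0 0 &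
  \det (rows3 p.1.1 p.1.2 p.2) = j].

Lemma aligned_rotx h j p c s : c ^+ 2 + s ^+ 2 = 1 ->
  aligned h j p -> aligned h j (rotate p (rotx c s)).
Proof.
move=> /is_rotx rA [? ? ? S ?]; split; rewrite /= ?dotp_rot ?det_rot//.
by rewrite -!mulmxDl S mul_row3 !scale_row3 !add_row3; congr row3; ring.
Qed.

Lemma sphere2E u : sphere2 u <-> dotp u u = 1.
Proof. by rewrite /sphere2/= enorm_eq// expr1n. Qed.

Lemma fiberP h i j p : 0 <= h -> fiber (h, i, j) p <->
  [/\ [/\ dotp p.1.1 p.1.1 = 1, dotp p.1.2 p.1.2 = 1 & dotp p.2 p.2 = 1],
   dotp (p.1.1 + p.1.2 + p.2) (p.1.1 + p.1.2 + p.2) = h ^+ 2,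
   dotp (p.1.1 + p.1.2 + p.2) e3 = i & \det (rows3 p.1.1 p.1.2 p.2) = j].
Proof.
move=> h0; case: p => -[X Y] Z; rewrite -(propext (enorm_eq _ h0)).
rewrite -!(propext (sphere2E _)) /fiber /HIJ /M /=.
split=> [[[[? ?] ?] [? ? ?]]|[[? ? ?] ? ? ?]]; split=> //=.
by congr (_, _, _).
Qed.

(** The first row of [roty r k *m rotz c s] is (r c, r s, k): the first axis is
    sent to the point of latitude k and longitude (c, s), so the third coordinate
    of the sum becomes h k. *)
Lemma fiber_rotate h j r k c s p : 0 <= h -> r ^+ 2 + k ^+ 2 = 1 ->
  c ^+ 2 + s ^+ 2 = 1 -> aligned h j p ->
  fiber (h, h * k, j) (rotate p (roty r k *m rotz c s)).
Proof.
move=> h0 /is_roty rA /is_rotz rB [? ? ? S ?].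
have rC := is_rotM rA rB.
apply/fiberP => //; split; rewrite /= ?det_rot//.
- by rewrite !dotp_rot.
- by rewrite -!mulmxDl dotp_rot// S dotp_row3; ring.
- rewrite -!mulmxDl S mulmxA !mul_row3 !scale_row3 !add_row3.
  by rewrite mul_row3 !scale_row3 !add_row3 dotp_e3; ring.
Qed.

(** Once |W| and its third coordinate are fixed, only the longitude psi of W is
    free, and undoing the corresponding rotation aligns the triple. *)
Lemma fiber_aligned h j r k p : 0 < h -> 0 <= r -> r ^+ 2 + k ^+ 2 = 1 ->
  fiber (h, h * k, j) p -> exists psi q, aligned h j q /\
    p = rotate q (roty r k *m rotz (cos psi) (sin psi)).
Proof.
move=> h0 r0 rk /(fiberP _ _ _ (ltW h0)) [[pX pY pZ]].
have [a [b [c S]]] := row3P (p.1.1 + p.1.2 + p.2).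
rewrite S dotp_row3 dotp_e3 => SS cE pJ.
have [psi [aE bE]] : exists psi, a = h * r * cos psi /\ b = h * r * sin psi.
  apply: polar_coordinates; first by rewrite mulr_ge0// ltW.
  have -> : (h * r) ^+ 2 = h ^+ 2 - (h * k) ^+ 2.
    by rewrite !exprMn -[r ^+ 2](addrK (k ^+ 2)) rk; ring.
  by rewrite -SS cE; ring.
have rA : is_rot (roty r k *m rotz (cos psi) (sin psi)).
  by apply: is_rotM; [exact: is_roty|apply: is_rotz; exact: cos2Dsin2].
set A := roty r k *m _ in rA.
exists psi, (rotate p A^T); rewrite rotateK//; split=> //.
have rT := is_rotT rA.
split; rewrite /= ?dotp_rot ?det_rot//.
have e : row3 a b c = row3 h 0 0 *m A.
  rewrite mulmxA !mul_row3 !scale_row3 !add_row3.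
  rewrite mul_row3 !scale_row3 !add_row3.
  by rewrite aE bE cE; congr row3; ring.
by rewrite -!mulmxDl S e -mulmxA; case: rA => -> _; rewrite mulmx1.
Qed.

(** * Normal forms *)

(** From here on W = (h, 0, 0), S = Y + Z = W - X and D = Y - Z. The unit vector X
    of height x is rotated about W into the half-plane spanned by the first axis
    and the positive second axis. *)
Definition lat_radius x := Num.sqrt (1 - x ^+ 2).

(** The third coordinate of D, read off from
    2 det(X, Y, Z) = <W x X, D>. It is 0 when X is a multiple of W, by the
    convention on the inverse of 0, and that is the value wanted there. *)
Definition diff_normal h j x := j *+ 2 / (h * lat_radius x).

(** The value of |S|^2. *)
Definition sq_sum h x := 1 + h ^+ 2 - h * x *+ 2.

(** The length of the projection of D to the plane of W and X, divided by |S|.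
    This projection is orthogonal to S, hence a multiple of (lat_radius x, h - x),
    a vector of the same length as S. *)
Definition diff_slope h j x :=
  Num.sqrt ((sq_diff h x - diff_normal h j x ^+ 2) / sq_sum h x).

(** The sign e = 1 or -1 chooses between the two vectors D compatible with X. *)
Definition normal_form e h j x : triples R :=
  let d1 := e * diff_slope h j x * lat_radius x in
  let d2 := e * diff_slope h j x * (h - x) in
  let d3 := diff_normal h j x in
  (row3 x (lat_radius x) 0,
   row3 ((h - x + d1) / 2) ((- lat_radius x + d2) / 2) (d3 / 2),
   row3 ((h - x - d1) / 2) ((- lat_radius x - d2) / 2) (- d3 / 2)).

Lemma lat_radius_sqr x : x ^+ 2 <= 1 -> lat_radius x ^+ 2 = 1 - x ^+ 2.
Proof. by move=> x1; rewrite sqr_sqrtr// subr_ge0. Qed.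

(** S = 0 means X = W, which forces h = 1 and makes the three vectors
    coplanar. *)
Lemma sq_sum_gt0 h j x : 0 < h -> ~ (h = 1 /\ j = 0) -> heights h j x ->
  0 < sq_sum h x.
Proof.
move=> h0 hj [x1 gx jx].
have e : sq_sum h x = (h - x) ^+ 2 + (1 - x ^+ 2) by rewrite /sq_sum; ring.
rewrite lt_def e addr_ge0 ?sqr_ge0 ?subr_ge0// andbT.
rewrite paddr_eq0 ?sqr_ge0 ?subr_ge0// sqrf_eq0 !subr_eq0.
apply/negP => /andP[/eqP hx /eqP x2].
apply: hj; split; first by rewrite hx; nra.
move: jx; rewrite -x2 subrr mul0r mulr0 => j0.
have : (j *+ 2) ^+ 2 == 0 by rewrite eq_le j0 sqr_ge0.
by rewrite sqrf_eq0 mulrn_eq0 => /eqP.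
Qed.

Lemma diff_normalE h j x : 0 < h -> heights h j x ->
  h * lat_radius x * diff_normal h j x = j *+ 2.
Proof.
move=> h0 [x1 gx jx].
have [r0|r0] := eqVneq (lat_radius x) 0.
  move: jx; rewrite -lat_radius_sqr// r0 expr0n/= mul0r mulr0 => j0.
  have : (j *+ 2) ^+ 2 == 0 by rewrite eq_le j0 sqr_ge0.
  by rewrite sqrf_eq0 => /eqP ->; rewrite mulr0 mul0r.
by rewrite mulrC divfK// mulf_neq0// gt_eqF.
Qed.

Lemma diff_normal_le h j x : 0 < h -> heights h j x ->
  diff_normal h j x ^+ 2 <= sq_diff h x.
Proof.
move=> h0 dx; have tE := diff_normalE h0 dx.
case: dx => x1 gx jx.
have [r0|r0] := eqVneq (lat_radius x) 0.
  by rewrite /diff_normal r0 mulr0 invr0 mulr0 expr0n.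
have r2 : 0 < lat_radius x ^+ 2 by rewrite lt_def sqr_ge0 sqrf_eq0 r0.
have h2 : 0 < h ^+ 2 by rewrite exprn_gt0.
rewrite -(ler_pM2l r2) -(ler_pM2l h2) {2}lat_radius_sqr//.
by apply: le_trans jx; rewrite -tE (exprMn _ (h * _)) (exprMn _ h) -mulrA.
Qed.

Lemma diff_slope_sqr h j x : 0 < h -> ~ (h = 1 /\ j = 0) -> heights h j x ->
  diff_slope h j x ^+ 2 * sq_sum h x = sq_diff h x - diff_normal h j x ^+ 2.
Proof.
move=> h0 hj dx; have l0 := sq_sum_gt0 h0 hj dx.
rewrite sqr_sqrtr ?divfK ?gt_eqF// divr_ge0 ?(ltW l0)//.
by rewrite subr_ge0 diff_normal_le.
Qed.

Lemma normal_form_aligned e h j x : 0 < h -> ~ (h = 1 /\ j = 0) -> e ^+ 2 = 1 ->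
  heights h j x -> aligned h j (normal_form e h j x).
Proof.
move=> h0 hj e1 dx; have tE := diff_normalE h0 dx.
have sE := diff_slope_sqr h0 hj dx.
have rE : lat_radius x ^+ 2 = 1 - x ^+ 2 by apply: lat_radius_sqr; case: dx.
have lE : (h - x) ^+ 2 + lat_radius x ^+ 2 = sq_sum h x.
  by rewrite rE /sq_sum; ring.
(* Y = (S + D) / 2 and Z = (S - D) / 2 with S and D orthogonal, hence 4 |Y|^2
   and 4 |Z|^2 are both |S|^2 + |D|^2, the left-hand side for f = e. *)
have halved (f : R) : f ^+ 2 = 1 ->
  ((h - x) ^+ 2 + lat_radius x ^+ 2) * (1 + f ^+ 2 * diff_slope h j x ^+ 2)
   + diff_normal h j x ^+ 2 = 4.
  move=> ->; rewrite lE mul1r mulrDr mulr1 [_ * diff_slope _ _ _ ^+ 2]mulrC sE.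
  by rewrite /sq_diff /sq_sum; ring.
split; rewrite /= ?dotp_row3 ?det_row3 ?add_row3.
- by rewrite -!expr2 rE; ring.
- apply: (mulfI (_ : 4 != 0)); rewrite ?pnatr_eq0//.
  rewrite mulr1 -[RHS](halved e)//; field; rewrite ?pnatr_eq0//.
- apply: (mulfI (_ : 4 != 0)); rewrite ?pnatr_eq0//.
  rewrite mulr1 -[RHS](halved e)//; field; rewrite ?pnatr_eq0//.
- by congr row3; field; rewrite ?pnatr_eq0//.
- apply: (mulfI (_ : 2 != 0)); rewrite ?pnatr_eq0//.
  rewrite [RHS]mulr_natl -tE; field; rewrite ?pnatr_eq0//.
Qed.

(** Given X, the vector D is orthogonal to S, has a prescribed length and a
    prescribed component along W x X; in the plane of W and X it is therefore
    determined up to sign. The last hypothesis fixes the rotation about W in the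
    case where X lies on the axis and leaves it undetermined. *)
Lemma aligned_normal_form h j x p : 0 < h -> ~ (h = 1 /\ j = 0) ->
  aligned h j p ->
  p.1.1 = row3 x (lat_radius x) 0 ->
  (lat_radius x = 0 -> exists a b, p.1.2 - p.2 = row3 a b 0) ->
  heights h j x /\ exists e, (e = 1 \/ e = -1) /\ p = normal_form e h j x.
Proof.
case: p => -[X Y] Z h0 hj [/= XX YY ZZ XYZ dJ] XE YZ.
have [y1 [y2 [y3 YE]]] := row3P Y; have [z1 [z2 [z3 ZE]]] := row3P Z.
rewrite {}XE {}YE {}ZE in XX YY ZZ XYZ dJ YZ *.
move: XX YY ZZ XYZ dJ YZ.
rewrite !dotp_row3 !add_row3 det_row3 => XX YY ZZ /row3_inj[h1 h2 h3] dJ YZ.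
have x1 : x ^+ 2 <= 1 by have := sqr_ge0 (lat_radius x); nra.
have rE := lat_radius_sqr x1.
pose a := y1 - z1; pose b := y2 - z2; pose g := y3 - z3.
(* (a, b, g) is D = Y - Z: first |D|^2 = 4 - |S|^2, then D.S = 0, then the
   determinant. *)
have gE : sq_diff h x = a ^+ 2 + b ^+ 2 + g ^+ 2.
  by rewrite /sq_diff /a /b /g; nra.
have ab : a * (h - x) = lat_radius x * b.
  have -> : h - x = y1 + z1 by rewrite -h1; ring.
  have -> : lat_radius x = - (y2 + z2) by lra.
  have z3E : z3 = - y3 by lra.
  rewrite /a /b; move: YY ZZ; rewrite z3E; nra.
have jE : h * lat_radius x * g = j *+ 2.
  rewrite -dJ /g -h1; have -> : z3 = - y3 by lra.
  have -> : y2 = - (lat_radius x + z2) by lra.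
  ring.
have dx : heights h j x.
  split=> //; first by rewrite gE !addr_ge0// sqr_ge0.
  rewrite -jE -rE (exprMn _ (h * _)) (exprMn _ h) -mulrA.
  rewrite ler_pM2l ?exprn_gt0// ler_wpM2l ?sqr_ge0// gE lerDr.
  by rewrite addr_ge0 ?sqr_ge0.
split=> //.
have ln0 : sq_sum h x != 0 by rewrite gt_eqF// (sq_sum_gt0 h0 hj dx).
have lE : (h - x) ^+ 2 + lat_radius x ^+ 2 = sq_sum h x.
  by rewrite rE /sq_sum; ring.
have tE : diff_normal h j x = g.
  have [r0|r0] := eqVneq (lat_radius x) 0.
    rewrite /diff_normal r0 mulr0 invr0 mulr0 /g.
    have [c [d]] := YZ r0; rewrite -scaleN1r scale_row3 add_row3.
    by move=> /row3_inj[_ _]; lra.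
  have hr : h * lat_radius x != 0 by rewrite mulf_neq0// gt_eqF.
  by apply: (mulfI hr); rewrite diff_normalE.
(* The component of D along the unit normal to S in the plane of W and X,
   divided by |S|. *)
pose k := (a * lat_radius x + b * (h - x)) / sq_sum h x.
have kE : k ^+ 2 = diff_slope h j x ^+ 2.
  apply: (mulIf ln0).
  rewrite diff_slope_sqr// tE gE addrK.
  apply: (mulIf ln0).
  transitivity ((a * lat_radius x + b * (h - x)) ^+ 2).
    by rewrite /k; field.
  rewrite -lE.
  transitivity ((a ^+ 2 + b ^+ 2) * ((h - x) ^+ 2 + lat_radius x ^+ 2)
    - (a * (h - x) - lat_radius x * b) ^+ 2); first by ring.
  by rewrite ab subrr expr0n subr0.
have kr : k * lat_radius x = a.
  apply: (mulIf ln0).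
  transitivity ((a * lat_radius x + b * (h - x)) * lat_radius x).
    by rewrite /k; field.
  transitivity (a * lat_radius x ^+ 2 + lat_radius x * b * (h - x)).
    by ring.
  by rewrite -ab -lE; ring.
have kh : k * (h - x) = b.
  apply: (mulIf ln0).
  transitivity ((a * lat_radius x + b * (h - x)) * (h - x)).
    by rewrite /k; field.
  rewrite -lE mulrDl mulrAC ab; ring.
have [e [e1 ke]] : exists e, (e = 1 \/ e = -1) /\ k = e * diff_slope h j x.
  have := eqf_sqr k (diff_slope h j x); rewrite kE eqxx => /esym/orP[] /eqP ->.
    by exists 1; split; [left|rewrite mul1r].
  by exists (-1); split; [right|rewrite mulN1r].
exists e; split=> //; rewrite /normal_form -ke kr kh tE /a /b /g.
congr (_, _, _); congr row3; lra.
Qed.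

Lemma rotxT c s : (rotx c s)^T = rotx c (- s).
Proof.
apply/matrixP => k l; rewrite !mxE.
by case: k l => [[|[|[|//]]] ?] [[|[|[|//]]] ?]; rewrite !mxE//= opprK.
Qed.

(** A rotation about the axis brings X to the half-plane; if X is on the axis, so
    is S, D is perpendicular to the axis, and the rotation is chosen so as to
    kill the third coordinate of D. *)
Lemma normal_form_onto h j p : 0 < h -> ~ (h = 1 /\ j = 0) -> aligned h j p ->
  exists x phi e, [/\ heights h j x, e = 1 \/ e = -1 &
    p = rotate (normal_form e h j x) (rotx (cos phi) (sin phi))].
Proof.
move=> h0 hj alp.
suff [x [phi [XE YZ]]] : exists x phi,
    p.1.1 = row3 x (lat_radius x) 0 *m rotx (cos phi) (sin phi) /\
    (lat_radius x = 0 -> exists a b,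
      p.1.2 - p.2 = row3 a b 0 *m rotx (cos phi) (sin phi)).
  have rA : is_rot (rotx (cos phi) (sin phi)).
    by apply: is_rotx; exact: cos2Dsin2.
  have [|||dx [e [e1 pE]]] := @aligned_normal_form h j x
      (rotate p (rotx (cos phi) (sin phi))^T) h0 hj.
  - rewrite rotxT; apply: aligned_rotx => //.
    by rewrite sqrrN cos2Dsin2.
  - by rewrite /= XE -mulmxA; case: rA => -> _; rewrite mulmx1.
  - move=> /YZ[a [b ab]]; exists a, b; rewrite /= -mulmxBl ab -mulmxA.
    by case: rA => -> _; rewrite mulmx1.
  by exists x, phi, e; split=> //; rewrite -pE rotateK.
have [x [y1 [y2 XE]]] := row3P p.1.1.
case: alp => + _ _ _ _; rewrite XE dotp_row3 => XX.
have x1 : x ^+ 2 <= 1 by have := sqr_ge0 y1; have := sqr_ge0 y2; nra.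
have rE := lat_radius_sqr x1.
have [r0|r0] := eqVneq (lat_radius x) 0.
  have [y10 y20] : y1 = 0 /\ y2 = 0.
    move: rE; rewrite r0 expr0n/= => rE; split; nra.
  have [a [b [c abc]]] := row3P (p.1.2 - p.2).
  have [|phi [bE cE]] := @polar_coordinates b c
      (Num.sqrt (b ^+ 2 + c ^+ 2)) (sqrtr_ge0 _).
    by rewrite sqr_sqrtr// addr_ge0// sqr_ge0.
  exists x, phi; rewrite abc; split=> [|_].
    rewrite mul_row3 !scale_row3 !add_row3 y10 y20 r0; congr row3; ring.
  exists a, (Num.sqrt (b ^+ 2 + c ^+ 2)).
  rewrite mul_row3 !scale_row3 !add_row3 -bE -cE; congr row3; ring.
have [|phi [y1E y2E]] := @polar_coordinates y1 y2 (lat_radius x)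
    (sqrtr_ge0 _).
  by rewrite rE -XX; ring.
exists x, phi; split=> [|r0']; last by rewrite r0' eqxx in r0.
rewrite mul_row3 !scale_row3 !add_row3 -y1E -y2E; congr row3; ring.
Qed.

(** * Continuity *)

Lemma continuous_mx (T : topologicalType) m n (F : T -> 'M[R]_(m, n)) (s : T) :
  (forall k l, {for s, continuous (fun x : T => F x k l)}) ->
  {for s, continuous F}.
Proof.
move=> cF; apply/cvg_mx_entourageP => A eA.
apply: filter_forall => k; apply: filter_forall => l.
have near_kl : \forall x \near nbhs s, A (F s k l, F x k l).
  by have /cvg_app_entourageP := cF k l; exact.
have : \forall x \near nbhs s, (F s k l, F x k l) \in A.
  by apply: filterS near_kl => x Ax; rewrite inE.
exact.
Qed.

Lemma continuous_mulmx (T : topologicalType) m n l (F : T -> 'M[R]_(m, n))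
    (G : T -> 'M[R]_(n, l)) (s : T) :
  {for s, continuous F} -> {for s, continuous G} ->
  {for s, continuous (fun x : T => F x *m G x)}.
Proof.
move=> cF cG; apply: continuous_mx => k k'.
have -> : (fun x : T => (F x *m G x) k k') =
    (fun x : T => \sum_m F x k m * G x m k').
  by apply/funext => x; rewrite mxE.
apply: cvg_big; first exact: add_continuous.
move=> m' _; apply: continuousM.
  exact: (continuous_comp cF (@coord_continuous _ _ _ k m' _)).
exact: (continuous_comp cG (@coord_continuous _ _ _ m' k' _)).
Qed.

Lemma continuous_row3 (f g k : R -> R) t : {for t, continuous f} ->
  {for t, continuous g} -> {for t, continuous k} ->
  {for t, continuous (fun x => row3 (f x) (g x) (k x))}.
Proof.
move=> cf cg ck; apply: continuous_mx => m l.
have -> : (fun x => row3 (f x) (g x) (k x) m l) =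
  (fun x => [:: f x; g x; k x]`_l) by apply/funext => x; rewrite mxE.
by case: l => [[|[|[|//]]] ?].
Qed.

Lemma continuous_rows3 (f g k : R -> 'rV[R]_3) t : {for t, continuous f} ->
  {for t, continuous g} -> {for t, continuous k} ->
  {for t, continuous (fun x => rows3 (f x) (g x) (k x))}.
Proof.
move=> cf cg ck; apply: continuous_mx => m l.
have -> : (fun x => rows3 (f x) (g x) (k x) m l) =
  (fun x => [:: f x; g x; k x]`_m 0 l) by apply/funext => x; rewrite mxE.
have cc (F : R -> 'rV[R]_3) : {for t, continuous F} ->
    {for t, continuous (fun x => F x 0 l)}.
  by move=> cF; exact: (continuous_comp cF (@coord_continuous _ _ _ 0 l _)).
by case: m => [[|[|[|//]]] ?]; exact: cc.
Qed.

Lemma continuous_pair (T U V : topologicalType) (f : T -> U) (g : T -> V)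
    (s : T) :
  {for s, continuous f} -> {for s, continuous g} ->
  {for s, continuous (fun x : T => (f x, g x))}.
Proof. by move=> cf cg; exact: cvg_pair. Qed.

Lemma continuous_rotate (f : R -> triples R) (F : R -> 'M[R]_3) t :
  {for t, continuous f} -> {for t, continuous F} ->
  {for t, continuous (fun x => rotate (f x) (F x))}.
Proof.
move=> cf cF; have cf1 : {for t, continuous (fun x => (f x).1)}.
  by apply: (continuous_comp cf); exact: cvg_fst.
have cX : {for t, continuous (fun x => (f x).1.1 *m F x)}.
  by apply: continuous_mulmx cF; apply: (continuous_comp cf1); exact: cvg_fst.
have cY : {for t, continuous (fun x => (f x).1.2 *m F x)}.
  by apply: continuous_mulmx cF; apply: (continuous_comp cf1); exact: cvg_snd.
have cZ : {for t, continuous (fun x => (f x).2 *m F x)}.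
  by apply: continuous_mulmx cF; apply: (continuous_comp cf); exact: cvg_snd.
exact: (continuous_pair (continuous_pair cX cY) cZ).
Qed.

Lemma continuous_rotx t : {for t, continuous (fun x => rotx (cos x) (sin x))}.
Proof.
have cc := @continuous_cos R t; have cs := @continuous_sin R t.
apply: continuous_rows3; apply: continuous_row3 => //; try exact: cvg_cst.
exact: continuousN.
Qed.

Lemma continuous_rotz t : {for t, continuous (fun x => rotz (cos x) (sin x))}.
Proof.
have cc := @continuous_cos R t; have cs := @continuous_sin R t.
apply: continuous_rows3; apply: continuous_row3 => //; try exact: cvg_cst.
exact: continuousN.
Qed.

Lemma continuous_lat_radius : continuous (lat_radius).
Proof.
move=> t; apply: continuous_comp; last exact: sqrt_continuous.
by apply: cvgB; [exact: cvg_cst|apply: cvgM].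
Qed.

Lemma continuous_sq_diff h t : {for t, continuous (sq_diff h)}.
Proof.
apply: cvgD; first exact: cvg_cst.
by apply: cvgD; apply: cvgM => //; exact: cvg_cst.
Qed.

(** The denominators do not vanish at admissible heights: |S| by [sq_sum_gt0], and
    the radius of the circle of latitude because it divides a multiple of j,
    except for j = 0, where [diff_normal] is identically 0. *)
Lemma continuous_normal_form e h j t : 0 < h -> ~ (h = 1 /\ j = 0) ->
  heights h j t -> {for t, continuous (normal_form e h j)}.
Proof.
move=> h0 hj dt.
have crad := @continuous_lat_radius t.
have ctor : {for t, continuous (diff_normal h j)}.
  have [j0|j0] := eqVneq j 0.
    have -> : diff_normal h j = cst 0.
      by apply/funext => x; rewrite /diff_normal j0 mul0rn mul0r.
    exact: cvg_cst.
  apply: continuousM; first exact: cvg_cst.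
  apply: continuousV; last by apply: continuousM => //; exact: cvg_cst.
  have := diff_normalE h0 dt; apply: contra_eqN => /eqP ->.
  by rewrite mul0r eq_sym mulrn_eq0.
have cslope : {for t, continuous (diff_slope h j)}.
  apply: continuous_comp; last exact: sqrt_continuous.
  apply: continuousM.
    by apply: cvgB; [exact: continuous_sq_diff|apply: cvgM].
  apply: continuousV; first by rewrite gt_eqF// (sq_sum_gt0 h0 hj dt).
  apply: cvgB; first exact: cvg_cst.
  by apply: cvgD; apply: cvgM => //; exact: cvg_cst.
have ces : {for t, continuous (fun x => e * diff_slope h j x)}.
  by apply: continuousM => //; exact: cvg_cst.
have chx : {for t, continuous (fun x => h - x)}.
  by apply: cvgB => //; exact: cvg_cst.
have halved (f : R -> R) : {for t, continuous f} ->
    {for t, continuous (fun x => f x / 2)}.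
  by move=> cf; apply: continuousM => //; exact: cvg_cst.
apply: continuous_pair; first apply: continuous_pair.
all: apply: continuous_row3 => //; try exact: cvg_cst.
- by apply: halved; apply: cvgD => //; apply: cvgM.
- by apply: halved; apply: cvgD; [exact: cvgN|apply: cvgM].
- exact: halved.
- by apply: halved; apply: cvgB => //; apply: cvgM.
- by apply: halved; apply: cvgB; [exact: cvgN|apply: cvgM].
- by apply: halved; exact: cvgN.
Qed.

(** * Connectedness of the fibers *)

Lemma connected_component_image (T : topologicalType) (E : set T) (f : R -> T)
    (D : set R) a b :
  is_interval D -> (forall t, D t -> {for t, continuous f}) ->
  (forall t, D t -> E (f t)) -> D a -> D b ->
  connected_component E (f a) (f b).
Proof.
move=> /connected_intervalP iD cf Ef Da Db.
apply: (@connected_component_max _ _ (f @` D)).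
- by exists a.
- by move=> _ [t Dt <-]; exact: Ef.
- apply: connected_continuous_connected => //.
  by apply: continuous_in_subspaceT => t; rewrite inE; exact: cf.
- by exists b.
Qed.

(** The sheet of sign e, parametrized by the height x of X, the angle phi about W
    and the longitude psi of W. *)
Definition chart r k h j e x phi psi : triples R :=
  rotate (normal_form e h j x) (rotx (cos phi) (sin phi) *m
    (roty r k *m rotz (cos psi) (sin psi))).

Lemma fiber_chart r k h j e x phi psi : 0 < h -> ~ (h = 1 /\ j = 0) ->
  r ^+ 2 + k ^+ 2 = 1 -> e = 1 \/ e = -1 -> heights h j x ->
  fiber (h, h * k, j) (chart r k h j e x phi psi).
Proof.
move=> h0 hj rk e1 dx; rewrite /chart rotateM.
apply: fiber_rotate; rewrite ?ltW ?cos2Dsin2//.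
apply: aligned_rotx; first exact: cos2Dsin2.
apply: normal_form_aligned => //.
by case: e1 => ->; rewrite ?sqrrN expr1n.
Qed.

(** The parameters are moved one at a time; only the height is restricted, to an
    interval by [heights_itv]. *)
Lemma chart_joined r k h j e x phi psi y phi' psi' :
  0 < h -> ~ (h = 1 /\ j = 0) -> r ^+ 2 + k ^+ 2 = 1 -> e = 1 \/ e = -1 ->
  heights h j x -> heights h j y ->
  connected_component (fiber (h, h * k, j))
    (chart r k h j e x phi psi) (chart r k h j e y phi' psi').
Proof.
move=> h0 hj rk e1 dx dy.
have iT : is_interval [set: R] by [].
apply: (@connected_component_trans _ _ (chart r k h j e y phi psi)).
  apply: (@connected_component_image _ _ (fun t => chart r k h j e t phi psi)
    (heights h j) x y _ _ _ dx dy) => [t s Dt Ds u tu|t dt|t dt].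
  - exact: heights_itv tu.
  - by apply: continuous_rotate; [exact: continuous_normal_form|exact: cvg_cst].
  - exact: fiber_chart.
apply: (@connected_component_trans _ _ (chart r k h j e y phi' psi)).
  apply: (@connected_component_image _ _ (fun t => chart r k h j e y t psi)
    [set: R] phi phi' iT _ _ I I) => t _; last exact: fiber_chart.
  apply: continuous_rotate; first exact: cvg_cst.
  by apply: continuous_mulmx; [exact: continuous_rotx|exact: cvg_cst].
apply: (@connected_component_image _ _ (fun t => chart r k h j e y phi' t)
  [set: R] psi psi' iT _ _ I I) => t _; last exact: fiber_chart.
apply: continuous_rotate; first exact: cvg_cst.
apply: continuous_mulmx; first exact: cvg_cst.
by apply: continuous_mulmx; [exact: cvg_cst|exact: continuous_rotz].
Qed.

Lemma diff_slope_eq0 h j x : 0 < h -> j != 0 -> x ^+ 2 <= 1 ->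
  0 <= sq_diff h x ->
  h ^+ 2 * ((1 - x ^+ 2) * sq_diff h x) = (j *+ 2) ^+ 2 ->
  heights h j x /\ diff_slope h j x = 0.
Proof.
move=> h0 j0 x1 gx jE.
have dx : heights h j x by split; rewrite ?jE.
split=> //; have tE := diff_normalE h0 dx.
have r0 : h * lat_radius x != 0.
  by apply: contra_neq j0 => r0; move: tE; rewrite r0 mul0r => /esym/eqP;
    rewrite mulrn_eq0 => /eqP.
rewrite /diff_slope (_ : sq_diff h x - _ = 0) ?mul0r ?sqrtr0//.
apply: (mulfI (_ : (h * lat_radius x) ^+ 2 != 0)); first by rewrite sqrf_eq0.
by rewrite mulr0 mulrBr -exprMn tE -jE exprMn lat_radius_sqr// mulrA subrr.
Qed.

Lemma normal_form_slope0 e e' h j x : diff_slope h j x = 0 ->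
  normal_form e h j x = normal_form e' h j x.
Proof. by rewrite /normal_form => ->; rewrite !mulr0. Qed.

(** For j = 0 and X on the axis, D is perpendicular to the axis and the half-turn
    about the axis exchanges the two signs. *)
Lemma normal_form_pole h :
  normal_form (-1) h 0 1 =
  rotate (normal_form 1 h 0 1) (rotx (-1) 0).
Proof.
have r0 : lat_radius 1 = 0 :> R by rewrite /lat_radius expr1n subrr sqrtr0.
have t0 : diff_normal h 0 1 = 0 by rewrite /diff_normal mul0rn mul0r.
rewrite /rotate /normal_form /= r0 t0 !mul_row3 !scale_row3 !add_row3.
by congr (_, _, _); congr row3; ring.
Qed.

(** For j = 0 the sheets share the points with X on the axis. For j <> 0 the
    height cannot grow up to 1, where the constraint defining [heights] fails; at
    the height where it becomes an equality, D is parallel to W x X, and the sign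
    does not matter. *)
Lemma sheets_meet r k h j : 0 < h -> ~ (h = 1 /\ j = 0) ->
  (exists x, heights h j x) ->
  exists x phi phi', heights h j x /\
    chart r k h j 1 x phi 0 = chart r k h j (-1) x phi' 0.
Proof.
move=> h0 hj [x [x1 gx jx]].
have [xN1 x_1] : -1 <= x /\ x <= 1 by split; nra.
have [j0|j0] := eqVneq j 0.
  exists 1, pi, 0; split.
    rewrite j0; split; rewrite ?expr1n//.
      by move: gx; rewrite /sq_diff; nra.
    by rewrite subrr mul0r mulr0 mul0rn expr0n.
  rewrite /chart rotateM [RHS]rotateM; congr (rotate _ _).
  rewrite j0 normal_form_pole -rotateM; congr rotate.
  rewrite cospi sinpi cos0 sin0.
  suff -> : rotx 1 0 = 1%:M :> 'M[R]_3 by rewrite mulmx1.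
  apply/matrixP => m l; rewrite !mxE.
  by case: m l => [[|[|[|//]]] ?] [[|[|[|//]]] ?]; rewrite !mxE//= oppr0.
pose F y := h ^+ 2 * ((1 - y ^+ 2) * sq_diff h y).
have [||y] := @IVT R F x 1 ((j *+ 2) ^+ 2) x_1.
- apply: continuous_subspaceT => t; apply: cvgM; first exact: cvg_cst.
  apply: cvgM; last exact: continuous_sq_diff.
  by apply: cvgB; [exact: cvg_cst|exact: cvgM].
- have F1 : F 1 = 0 by rewrite /F expr1n subrr mul0r mulr0.
  by rewrite F1 ge_min le_max sqr_ge0 [_ <= F x]jx orbT.
rewrite in_itv/= => /andP[xy y1] Fy.
have [||dy sy] := diff_slope_eq0 h0 j0 _ _ Fy.
- nra.
- by move: gx; rewrite /sq_diff; nra.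
exists y, 0, 0; split=> //; rewrite /chart.
by rewrite (normal_form_slope0 1 (-1) sy).
Qed.

Lemma connected_fiber h i j : 0 < h -> ~ (h = 1 /\ j = 0) ->
  connected (@fiber R (h, i, j)).
Proof.
move=> h0 hj.
have [->|/set0P[p0 Fp0]] := eqVneq (@fiber R (h, i, j)) set0.
  exact: connected0.
pose k := i / h; pose r := Num.sqrt (1 - k ^+ 2).
have iE : i = h * k by rewrite mulrC divfK// gt_eqF.
have rk : r ^+ 2 + k ^+ 2 = 1.
  have [_ + + _] := (fiberP _ _ _ (ltW h0)).1 Fp0.
  have [a [b [c ->]]] := row3P (p0.1.1 + p0.1.2 + p0.2).
  rewrite dotp_row3 dotp_e3 iE => abc cE.
  have k1 : k ^+ 2 <= 1.
    have h2 : 0 < h ^+ 2 by rewrite exprn_gt0.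
    rewrite -(ler_pM2l h2) -exprMn -cE; nra.
  by rewrite sqr_sqrtr ?subrK// subr_ge0.
rewrite iE in Fp0 *.
have charted p : fiber (h, h * k, j) p -> exists e x phi psi,
    [/\ e = 1 \/ e = -1, heights h j x & p = chart r k h j e x phi psi].
  move=> /(fiber_aligned h0 (sqrtr_ge0 _) rk)[psi [q []]].
  move=> /(normal_form_onto h0 hj).
  move=> [x [phi [e [dx e1 ->]]]] ->.
  by exists e, x, phi, psi; rewrite /chart -rotateM.
have [_ [x0 [_ [_ [_ dx0 _]]]]] := charted _ Fp0.
have [x [phi [phi' [dx meet]]]] := sheets_meet r k h0 hj (ex_intro _ _ dx0).
have sheets p : fiber (h, h * k, j) p ->
    connected_component (fiber (h, h * k, j)) (chart r k h j 1 x phi 0) p.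
  move=> /charted[e [y [chi [psi [[->|->] dy ->]]]]].
    by apply: chart_joined => //; left.
  by rewrite meet; apply: chart_joined => //; right.
rewrite (_ : fiber _ = connected_component (fiber (h, h * k, j))
  (chart r k h j 1 x phi 0)); first exact: component_connected.
apply/seteqP; split=> //; exact: connected_component_sub.
Qed.

(** * A critical value *)

(** H is the square root of <S, S> for the linear map S = X + Y + Z, so its
    differential is <S(p), S(q)> / H(p). *)
Lemma diff_fH_orthogonal p q : fH p <> 0 ->
  dotp (p.1.1 + p.1.2 + p.2) (q.1.1 + q.1.2 + q.2) = 0 -> 'd (@fH R) p q = 0.
Proof.
move=> Hp pq.
pose s (k : 'I_3) (q : triples R) : R := (q.1.1 + q.1.2 + q.2) 0 k.
have ds k : is_diff p (s k : triples R -> R^o) (s k).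
  have sl : linear (s k : triples R -> R^o).
    move=> t q1 q2.
    transitivity ((t *: q1.1.1 + q2.1.1 + (t *: q1.1.2 + q2.1.2)
      + (t *: q1.2 + q2.2)) 0 k); first by [].
    rewrite /s !mxE /GRing.scale /=; ring.
  pose sM := GRing.isLinear.Build _ _ _ _ (s k : triples R -> R^o) sl.
  pose sL : {linear triples R -> R^o} := HB.pack (s k : triples R -> R^o) sM.
  have sc : continuous (s k : triples R -> R^o).
    move=> q1; rewrite /s.
    have -> : (fun q : triples R => (q.1.1 + q.1.2 + q.2) 0 k) =
      (fun q : triples R => q.1.1 0 k + q.1.2 0 k + q.2 0 k).
      by apply/funext => q'; rewrite !mxE.
    have cc (f : triples R -> 'rV[R]_3) : {for q1, continuous f} ->
        {for q1, continuous (fun q => f q 0 k)}.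
      by move=> cf; exact: (continuous_comp cf (@coord_continuous _ _ _ 0 k _)).
    apply: cvgD; first apply: cvgD.
    - apply: (cc (fun q : triples R => q.1.1)).
      by apply: continuous_comp; exact: cvg_fst.
    - apply: (cc (fun q : triples R => q.1.2)).
      by apply: continuous_comp; [exact: cvg_fst|exact: cvg_snd].
    - by apply: (cc (fun q : triples R => q.2)); exact: cvg_snd.
  apply: DiffDef; first exact: (@linear_differentiable _ _ _ sL).
  by rewrite (@diff_lin _ _ _ sL).
pose g : triples R -> R := s 0 * s 0 + s 1 * s 1 + s ord_max * s ord_max.
have gE q' : g q' = dotp (q'.1.1 + q'.1.2 + q'.2) (q'.1.1 + q'.1.2 + q'.2).
  by rewrite /dotp sum3E.
have fHE : @fH R = (Num.sqrt : R -> R) \o g.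
  by apply/funext => q'; rewrite /= gE; case: q' => -[].
have dg := is_diffD (is_diffD (is_diffM (ds 0) (ds 0)) (is_diffM (ds 1) (ds 1)))
  (is_diffM (ds ord_max) (ds ord_max)).
have gp : 0 < g p.
  rewrite lt_def gE dotp_ge0 andbT; apply/eqP => g0; apply: Hp.
  by rewrite fHE /= gE g0 sqrtr0.
rewrite fHE diff_comp; last 2 first.
- by case: dg.
- by apply/derivable1_diffP; case: (is_derive1_sqrt gp).
rewrite /= [X in 'd _ _ X](_ : _ = 0) ?linear0//.
rewrite (diff_val (is_diff_def := dg)).
transitivity (2 * dotp (p.1.1 + p.1.2 + p.2) (q.1.1 + q.1.2 + q.2)).
  have sq k : s k p * s k q =
    (p.1.1 + p.1.2 + p.2) 0 k * (q.1.1 + q.1.2 + q.2) 0 k by [].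
  rewrite /dotp sum3E -!sq.
  transitivity (s 0 p * s 0 q + s 0 p * s 0 q + (s 1 p * s 1 q + s 1 p * s 1 q)
    + (s ord_max p * s ord_max q + s ord_max p * s ord_max q)); first by [].
  ring.
by rewrite pq mulr0.
Qed.

(** At (W, W, -W) the sum is W, which is orthogonal to every tangent vector in
    each of the three factors: the differential of H vanishes on the tangent
    space of M. *)
Lemma critical_value_antipodal k : k ^+ 2 <= 1 -> @critical_values R (1, k, 0).
Proof.
move=> k1; pose W : 'rV[R]_3 := row3 (lat_radius k) 0 k.
have WW : dotp W W = 1.
  by rewrite dotp_row3 -!expr2 lat_radius_sqr//; ring.
have Wp : W + W + - W = W by rewrite addrK.
have fp : fiber (1, k, 0) (W, W, - W).
  apply/fiberP => //=; split; rewrite ?Wp ?WW ?expr1n//.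
  - split=> //; rewrite -scaleN1r scale_row3 dotp_row3.
    move: WW; rewrite dotp_row3; lra.
  - exact: dotp_e3.
  - rewrite -scaleN1r scale_row3 det_row3; ring.
case: fp => Mp Hp.
exists (W, W, - W) => //; split=> //.
have H1 : fH (W, W, - W) = 1 by case: Hp.
right; split; first by rewrite H1; apply/eqP; rewrite oner_eq0.
exists 1, 0, 0; split=> [[] /eqP|q [/= q1 q2 q3]]; first by rewrite oner_eq0.
rewrite !mul0r !addr0 mul1r diff_fH_orthogonal ?H1//=.
  by apply/eqP; rewrite oner_eq0.
rewrite Wp.
have -> : dotp W (q.1.1 + q.1.2 + q.2) =
    dotp q.1.1 W + dotp q.1.2 W - dotp q.2 (- W).
  rewrite /dotp -!big_split -sumrB /=; apply: eq_bigr => m _.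
  by rewrite !mxE; ring.
by rewrite q1 q2 q3 subr0 addr0.
Qed.

End Fibers.

(** Regularity serves to rule out H = 0 and the pair H = 1, J = 0. *)
Theorem theorem6p1 (R : realType) (c : R * R * R) :
  (@HIJ R @` @M R) c -> ~ critical_values c -> connected (fiber c).
Proof.
case: c => -[h i] j [p Mp pc] ncv.
have fp : fiber (h, i, j) p by [].
have h0 : 0 < h.
  rewrite lt_def; apply/andP; split.
    apply/eqP => h0; apply: ncv; exists p => //; split=> //; left.
    by case: pc => ->.
  by case: pc => <- _ _; case: p {Mp fp} => -[X Y] Z; exact: sqrtr_ge0.
apply: connected_fiber => // -[h1 j0]; apply: ncv.
rewrite h1 j0; apply: critical_value_antipodal.
have [_ + + _] := (fiberP _ _ _ (ltW h0)).1 fp.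
have [a [b [c ->]]] := row3P (p.1.1 + p.1.2 + p.2).
rewrite dotp_row3 dotp_e3 h1 expr1n => + <-; have := sqr_ge0 a; nra.
Qed.
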